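(* Let $P$ be a finite poset and let $M\subseteq P$ be the set of maximal elements of $P$. Then the order-dual of $LC(P)$ is isomorphic to the interval between $\overline{M}$ and $P$ in $L_{mlb}(P)$.
   Context: A closure relation on a poset $P$ is a map $H:P\to P$ such that for all $x,y\in P$: (1) $x\le H(x)$; (2) $x\le y$ implies $H(x)\le H(y)$; (3) $H(H(x))=H(x)$. $LC(P)$ is the lattice of all closure relations on $P$, ordered by $H\le K$ if and only if $H(x)\le K(x)$ for all $x\in P$. For $B\subseteq P$, a maximal lower bound of $B$ is a maximal element of the set $\{x\in P: x\le b \text{ for all } b\in B\}$. A subset $A\subseteq P$ is mlb-closed if for every subset $B\subseteq A$ (including $B=\emptyset$, whose maximal lower bounds are the maximal elements of $P$), all maximal lower bounds of $B$ in $P$ belong to $A$. For $A\subseteq P$, its mlb-closure $\overline{A}$ is the intersection of all mlb-closed subsets of $P$ containing $A$. $L_{mlb}(P)$ is the lattice of all mlb-closed subsets of $P$ ordered by inclusion. *)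

(* Defs.v *)
From HB Require Import structures.
From mathcomp Require Import all_boot all_order.

Set Implicit Arguments.
Unset Strict Implicit.
Unset Printing Implicit Defensive.

Import Order.TTheory.
Local Open Scope order_scope.

(* Between lattices, an order isomorphism is the same as a lattice isomorphism,
   meets and joins being determined by the order. *)
Definition order_isomorphic d1 d2 (T1 : porderType d1) (T2 : porderType d2) :
    Prop :=
  exists2 f : T1 -> T2, bijective f & {mono f : x y / x <= y}.

Section Interval.
Variables (d : Order.disp_t) (L : porderType d) (a b : L).

Record interval_of := IntervalOf {
  itv_elt :> L;
  itv_bounds : a <= itv_elt <= b
}.

HB.instance Definition _ := [isSub for itv_elt].
HB.instance Definition _ := [Choice of interval_of by <:].
HB.instance Definition _ := [SubChoice_isSubPOrder of interval_of by <: with d].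

End Interval.

Section FinitePoset.
Variables (d : Order.disp_t) (P : finPOrderType d).
Implicit Types (A B S : {set P}) (x y : P).

Definition is_closure (H : {ffun P -> P}) : bool :=
  [&& [forall x, x <= H x],
      [forall x, forall y, (x <= y) ==> (H x <= H y)] &
      [forall x, H (H x) == H x]].

Record LC := ClosureRelation {
  closure_fun :> {ffun P -> P};
  closure_funP : is_closure closure_fun
}.

HB.instance Definition _ := [isSub for closure_fun].
HB.instance Definition _ := [Finite of LC by <:].

Definition LC_le (H K : LC) : bool := [forall x, H x <= K x].

Fact LC_le_refl : reflexive LC_le.
Proof. by move=> H; apply/forallP. Qed.

Fact LC_le_anti : antisymmetric LC_le.
Proof.
move=> H K /andP[/forallP HK /forallP KH]; apply/val_inj/ffunP => x.
by apply/le_anti; rewrite HK KH.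
Qed.

Fact LC_le_trans : transitive LC_le.
Proof.
move=> K H J /forallP HK /forallP KJ; apply/forallP => x.
exact: le_trans (HK x) (KJ x).
Qed.

Fact LC_display : Order.disp_t. Proof. exact: Order.Disp tt tt. Qed.

HB.instance Definition _ :=
  Order.Le_isPOrder.Build LC_display LC LC_le_refl LC_le_anti LC_le_trans.

Definition maximal_elts S : {set P} :=
  [set x in S | [forall y in S, (x <= y) ==> (y == x)]].

Definition lower_bounds B : {set P} := [set x | [forall b in B, x <= b]].

Definition mlb B : {set P} := maximal_elts (lower_bounds B).

(* B may be empty: lower_bounds set0 is the whole poset, so an mlb-closed set
   contains every maximal element. *)
Definition mlb_closed A : bool :=
  [forall B : {set P}, (B \subset A) ==> (mlb B \subset A)].

Definition mlb_closure A : {set P} :=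
  \bigcap_(C : {set P} | mlb_closed C && (A \subset C)) C.

Record Lmlb := MlbClosed {
  mlb_set :> {set P};
  mlb_setP : mlb_closed mlb_set
}.

HB.instance Definition _ := [isSub for mlb_set].
HB.instance Definition _ := [Finite of Lmlb by <:].

Definition Lmlb_le (A B : Lmlb) : bool := (A : {set P}) \subset (B : {set P}).

Fact Lmlb_le_refl : reflexive Lmlb_le.
Proof. by move=> A; apply: subxx. Qed.

Fact Lmlb_le_anti : antisymmetric Lmlb_le.
Proof. by move=> A B AB; apply/val_inj/eqP; rewrite eqEsubset. Qed.

Fact Lmlb_le_trans : transitive Lmlb_le.
Proof. by move=> B A C; apply: subset_trans. Qed.

Fact Lmlb_display : Order.disp_t. Proof. exact: Order.Disp tt tt. Qed.

HB.instance Definition _ :=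
  Order.Le_isPOrder.Build Lmlb_display Lmlb Lmlb_le_refl Lmlb_le_anti Lmlb_le_trans.

Fact mlb_closure_closed A : mlb_closed (mlb_closure A).
Proof.
apply/forallP => B; apply/implyP => /bigcapsP BA.
apply/bigcapsP => C CA; have /andP[/forallP/(_ B)/implyP + _] := CA.
by apply; apply: BA.
Qed.

Fact mlb_closed_setT : mlb_closed [set: P].
Proof. by apply/forallP => B; rewrite !subsetT. Qed.

Definition mlb_closure_Lmlb A : Lmlb := MlbClosed (mlb_closure_closed A).
Definition Lmlb_full : Lmlb := MlbClosed mlb_closed_setT.

End FinitePoset.

(* Main.v *)
Require Import Defs.
From mathcomp Require Import all_boot all_order.
Import Order.TTheory.
Local Open Scope order_scope.

(** A closure relation is determined by its set of fixed points, and the larger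
    the relation, the fewer points it fixes; so [H |-> fixpoints H] is the
    isomorphism.  What has to be seen is that the sets of fixed points are
    exactly the mlb-closed sets.

    If [B] consists of fixed points of [H] and [m] is a maximal lower bound of
    [B], then monotonicity makes [H m] a lower bound of [B] above [m], so
    [H m = m] ([fixpoints_mlb_closed]).

    Conversely, let [A] be mlb-closed.  By finiteness [x] lies below some
    maximal lower bound [m] of the set of all elements of [A] above [x]; then
    [m] is in [A], hence it is the least element of [A] above [x]
    ([mlb_closed_least_above]).  Sending each [x] to that element is a closure
    relation whose fixed points are the elements of [A]
    ([fixpoints_least_above]).

    Finally, taking [B] empty shows that every mlb-closed set contains the
    maximal elements, so the interval is all of the lattice of mlb-closed
    sets ([mlb_closed_maximal_elts]). *)

Section ClosureRelations.
Context {d : Order.disp_t} {P : finPOrderType d}.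
Implicit Types (A B S : {set P}) (x y : P).

Lemma mem_lower_bounds B x :
  reflect (forall b, b \in B -> x <= b) (x \in lower_bounds B).
Proof. by rewrite inE; apply: forall_inP. Qed.

Lemma maximal_eltsP S x :
  reflect (x \in S /\ forall y, y \in S -> x <= y -> y = x)
          (x \in maximal_elts S).
Proof.
rewrite inE; apply: (iffP andP) => -[Sx].
  by move=> /forall_inP max_x; split=> // y /max_x /implyP + le_xy => /(_ le_xy)/eqP.
move=> max_x; split=> //; apply/forall_inP => y Sy.
by apply/implyP => /(max_x y Sy) ->.
Qed.

Lemma mlb_closedP A :
  reflect (forall B, B \subset A -> mlb B \subset A) (mlb_closed A).
Proof. by apply: (iffP forallP) => clA B; apply/implyP; apply: clA. Qed.

(** Among the elements of [S] above [x], one with the largest number of elements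
    below it is maximal. *)
Lemma maximal_elts_above S x :
  x \in S -> exists2 m, m \in maximal_elts S & x <= m.
Proof.
move=> Sx; have Sxx : (x \in S) && (x <= x) by rewrite Sx lexx.
case: (@arg_maxnP P x (fun y => (y \in S) && (x <= y))
         (fun y => #|[set z | z <= y]|) Sxx) => m /andP[Sm le_xm] max_m.
exists m => //; apply/maximal_eltsP; split=> // y Sy le_my.
have sub_my : [set z | z <= m] \subset [set z | z <= y].
  by apply/subsetP => z; rewrite !inE => /le_trans; apply.
have /eqP eq_my : [set z | z <= m] == [set z | z <= y].
  by rewrite eqEcard sub_my; apply: max_m; rewrite Sy (le_trans le_xm).
apply/le_anti; rewrite le_my andbT.
by move/setP/(_ y): eq_my; rewrite !inE lexx => ->.
Qed.

Section FixedPoints.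
Variable H : LC P.

Lemma le_closure x : x <= H x.
Proof. by have /and3P[/forallP] := closure_funP H. Qed.

Lemma closure_mono x y : x <= y -> H x <= H y.
Proof. by have /and3P[_ /forallP/(_ x)/forallP/(_ y)/implyP] := closure_funP H. Qed.

Lemma closure_idem x : H (H x) = H x.
Proof. by have /and3P[_ _ /forallP/(_ x)/eqP] := closure_funP H. Qed.

Definition fixpoints : {set P} := [set x | H x == x].

Lemma mem_fixpoints x : (x \in fixpoints) = (H x == x).
Proof. by rewrite inE. Qed.

Lemma fixpoints_mlb_closed : mlb_closed fixpoints.
Proof.
apply/mlb_closedP => B /subsetP fixB.
apply/subsetP => m /maximal_eltsP[/mem_lower_bounds lb_m max_m].
rewrite mem_fixpoints; apply/eqP/max_m; last exact: le_closure.
apply/mem_lower_bounds => b Bb.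
by have := fixB b Bb; rewrite mem_fixpoints => /eqP <-; apply/closure_mono/lb_m.
Qed.

End FixedPoints.

(** [K x] is fixed by [K]; if [H] fixes it too, then [H x <= H (K x) = K x]. *)
Lemma fixpoints_subset (H K : LC P) :
  (fixpoints K \subset fixpoints H) = (H <= K).
Proof.
apply/subsetP/forallP => [fixKH x | leHK x].
  have := fixKH (K x); rewrite !mem_fixpoints closure_idem eqxx => /(_ isT)/eqP <-.
  exact/closure_mono/le_closure.
rewrite !mem_fixpoints => /eqP Kx; apply/eqP/le_anti.
by rewrite le_closure andbT -{2}Kx leHK.
Qed.

Lemma fixpoints_inj : injective fixpoints.
Proof.
by move=> H K eqHK; apply/le_anti; rewrite -!fixpoints_subset eqHK subxx.
Qed.

Lemma mlb_closed_maximal_elts A :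
  mlb_closed A -> maximal_elts [set: P] \subset A.
Proof.
move=> /mlb_closedP/(_ set0 (sub0set A)); rewrite /mlb.
suff -> : lower_bounds (set0 : {set P}) = [set: P] by [].
by apply/setP => x; rewrite in_setT; apply/mem_lower_bounds => b; rewrite in_set0.
Qed.

Lemma mlb_closed_least_above A x : mlb_closed A ->
  exists m, [/\ m \in A, x <= m & forall a, a \in A -> x <= a -> m <= a].
Proof.
move=> /mlb_closedP clA; pose B := [set a in A | x <= a].
have /maximal_elts_above[m mlb_m le_xm] : x \in lower_bounds B.
  by apply/mem_lower_bounds => b; rewrite inE => /andP[].
exists m; split=> // [|a Aa le_xa].
  have sBA : B \subset A by apply/subsetP => b; rewrite inE => /andP[].
  exact: (subsetP (clA B sBA)).
have /maximal_eltsP[/mem_lower_bounds lb_m _] := mlb_m.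
by apply: lb_m; rewrite inE Aa.
Qed.

Section LeastAbove.
Variables (A : {set P}) (clA : mlb_closed A).

Definition least_above : {ffun P -> P} :=
  [ffun x => odflt x
     [pick m in A | (x <= m) && [forall a in A, (x <= a) ==> (m <= a)]]].

Lemma least_aboveP x :
  [/\ least_above x \in A, x <= least_above x
    & forall a, a \in A -> x <= a -> least_above x <= a].
Proof.
rewrite ffunE; case: pickP => [m /and3P[Am le_xm /forall_inP min_m] | none] /=.
  by split=> // a /min_m/implyP.
(* The default value never occurs: [pick] cannot fail on an mlb-closed set. *)
have [m [Am le_xm min_m]] := mlb_closed_least_above A x clA.
have /negP[] := negbT (none m); rewrite Am le_xm /=.
by apply/forall_inP => a Aa; apply/implyP/min_m.
Qed.

Lemma least_above_id x : x \in A -> least_above x = x.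
Proof.
move=> Ax; have [_ le_x min_x] := least_aboveP x.
by apply/le_anti; rewrite le_x min_x.
Qed.

Lemma least_above_is_closure : is_closure least_above.
Proof.
apply/and3P; split; apply/forallP => x; have [Ax le_x min_x] := least_aboveP x.
- by [].
- apply/forallP => y; apply/implyP => le_xy.
  by have [Ay le_y _] := least_aboveP y; apply/min_x/(le_trans le_xy).
- by rewrite least_above_id.
Qed.

Lemma fixpoints_least_above :
  fixpoints (ClosureRelation least_above_is_closure) = A.
Proof.
apply/setP => x; rewrite mem_fixpoints /=; apply/eqP/idP => [<-|].
  by have [] := least_aboveP x.
exact: least_above_id.
Qed.

End LeastAbove.

Local Notation mlb_interval :=
  (interval_of (mlb_closure_Lmlb (maximal_elts [set: P])) (Lmlb_full P)).

Lemma mlb_interval_bounds (A : Lmlb P) :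
  mlb_closure_Lmlb (maximal_elts [set: P]) <= A <= Lmlb_full P.
Proof.
apply/andP; split; last exact: subsetT.
by apply: bigcap_inf; rewrite mlb_setP mlb_closed_maximal_elts ?mlb_setP.
Qed.

Definition fixpoints_itv (H : (LC P)^d) : mlb_interval :=
  IntervalOf (mlb_interval_bounds (MlbClosed (fixpoints_mlb_closed H))).

Definition least_above_LC (A : mlb_interval) : (LC P)^d :=
  ClosureRelation (least_above_is_closure _ (mlb_setP (itv_elt A))).

Lemma least_above_LCK : cancel least_above_LC fixpoints_itv.
Proof.
by move=> A; apply: val_inj; apply: val_inj; apply: fixpoints_least_above.
Qed.

Lemma fixpoints_itvK : cancel fixpoints_itv least_above_LC.
Proof. by move=> H; apply: fixpoints_inj; apply: fixpoints_least_above. Qed.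

End ClosureRelations.

Theorem theorem4 (d : Order.disp_t) (P : finPOrderType d) :
  order_isomorphic (LC P)^d
    (interval_of (mlb_closure_Lmlb (maximal_elts [set: P])) (Lmlb_full P)).
Proof.
exists fixpoints_itv; last by move=> H K; apply: fixpoints_subset.
by exists least_above_LC; [apply: fixpoints_itvK | apply: least_above_LCK].
Qed.
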